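(* Let $\alpha=(a_1,\ldots,a_n)\in PP_n$ and suppose that all cars follow the $k$-Naples parking rule, with $k\ge 1$. Let $[p,q]\subseteq U_\alpha$ be a maximal interval. The following are equivalent: (i) restricting to the cars having preference at least $p$ (that is, running the $k$-Naples parking process on the street with spots $1,\ldots,n$ only with the cars $c_i$ with $a_i\ge p$, in their original order), spot $p-1$ is occupied by some car; (ii) there exists $J\subseteq[n]$, with $|J|\ge q-p+2$ and $a_j\in[p,\,p-2+|J|]$ for all $j\in J$, such that $\tau_{p-2}(\alpha_{|_J})\in PF_{|J|,k}$ is a complete $k$-Naples parking function. Each of these conditions is guaranteed to be satisfied when $|[p,q]|\le k$ (where $|[p,q]|=q-p+1$). Moreover, $\alpha\in PF_{n,k}$ if and only if all maximal intervals of $U_\alpha$ having size at least $k+1$ satisfy any of the (equivalent) conditions (i), (ii).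
   Context: For integers $a\le b$, $[a,b]=\{a,\ldots,b\}$ (empty if $a>b$) and $[n]=[1,n]$. A parking preference of length $n$ is a tuple $\alpha=(a_1,\ldots,a_n)$ with entries in $[n]$; $PP_n$ is the set of these. Cars $c_1,\ldots,c_n$ arrive in this order at a one-way street with spots $1,\ldots,n$, and $a_i$ is the preferred spot of $c_i$. $k$-Naples parking rule: car $c_i$ parks in spot $a_i$ if it is free; otherwise it checks one at a time the spots $a_i-1,a_i-2,\ldots,a_i-k$ (only those that are $\ge 1$), parking in the first free one found; if none is free, it proceeds forward and parks in the first free spot $>a_i$, if any; otherwise it fails to park. $PF_{n,k}$, the set of $k$-Naples parking functions of length $n$, is the set of $\alpha\in PP_n$ for which all cars park under this rule. $|\alpha|_i$ is the number of indices $h$ with $a_h=i$. The excess function is $u_\alpha(j)=\sum_{i=j}^n|\alpha|_i-(n-j+1)$ for $j\in[n]$, and $U_\alpha=\{j\in[n] : u_\alpha(j)\ge 1\}$ (note $1\notin U_\alpha$, so $p\ge 2$). A maximal interval $[p,q]\subseteq U_\alpha$ is a nonempty interval of consecutive integers contained in $U_\alpha$ that is maximal under inclusion. For $n\ge 2$, $\alpha\in PP_n$ is complete if $U_\alpha=[2,n]$; a complete $k$-Naples parking function is a complete parking preference that is a $k$-Naples parking function. For $w\in\mathbb Z$ the $w$-shift of a tuple $(b_1,\ldots,b_h)$ is $\tau_w(b_1,\ldots,b_h)=(b_1-w,\ldots,b_h-w)$. For $J=\{j_1<\cdots<j_h\}\subseteq[n]$, the restriction is $\alpha_{|_J}=(a_{j_1},\ldots,a_{j_h})$.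 *)

(* Defs.v *)
From mathcomp Require Import all_boot all_order all_algebra.

Set Implicit Arguments.
Unset Strict Implicit.
Unset Printing Implicit Defensive.

Definition PP (n : nat) (alpha : n.-tuple nat) : bool :=
  all (fun a => 1 <= a <= n) alpha.

(* The spots examined by a car with preference a, in order:
   a, then a-1, ..., a-k as long as they are >= 1, then a+1, ..., n. *)
Definition candidates (n k a : nat) : seq nat :=
  a :: [seq a - d | d <- iota 1 k & d < a] ++ iota a.+1 (n - a).

Definition park_car (n k : nat) (occ : seq nat) (a : nat) : option nat :=
  ohead [seq s <- candidates n k a | s \notin occ].

(* The list of outcomes, one per car in order of arrival: Some s if the car
   parks in spot s, None if it fails to park (later cars still proceed). The
   number of cars is independent of the number n of spots; occ lists the spots
   already occupied. *)
Fixpoint park_from (n k : nat) (occ cars : seq nat) : seq (option nat) :=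
  if cars is a :: cars' then
    let o := park_car n k occ a in
    o :: park_from n k (if o is Some s then s :: occ else occ) cars'
  else [::].

Definition park (n k : nat) (cars : seq nat) : seq (option nat) :=
  park_from n k [::] cars.

Definition PF (n k : nat) (alpha : n.-tuple nat) : bool :=
  PP alpha && all isSome (park n k alpha).

Definition excess (n : nat) (alpha : n.-tuple nat) (j : nat) : int :=
  ((\sum_(j <= i < n.+1) count_mem i alpha)%:Z - (n%:Z - j%:Z + 1))%R.

Definition U (n : nat) (alpha : n.-tuple nat) : pred nat :=
  fun j => (1 <= j <= n) && (1 <= excess alpha j)%R.

Definition interval_in (A : pred nat) (p q : nat) : Prop :=
  p <= q /\ forall j, p <= j <= q -> A j.

Definition maximal_interval (A : pred nat) (p q : nat) : Prop :=
  interval_in A p q /\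
  forall p' q', interval_in A p' q' -> p' <= p -> q <= q' -> p' = p /\ q' = q.

Definition complete (n : nat) (alpha : n.-tuple nat) : Prop :=
  [/\ 2 <= n, PP alpha & forall j, U alpha j = (2 <= j <= n)].

Definition complete_PF (n k : nat) (alpha : n.-tuple nat) : Prop :=
  complete alpha /\ PF k alpha.

(* Truncated subtraction: only meant for w smaller than every entry. *)
Definition shift (w h : nat) (b : h.-tuple nat) : h.-tuple nat :=
  map_tuple (fun x => x - w) b.

(* The ordinal i : 'I_n stands for the index i+1 of [n]; enum lists J in
   increasing order. *)
Definition restriction (n : nat) (alpha : n.-tuple nat) (J : {set 'I_n}) :
    #|J|.-tuple nat :=
  map_tuple (tnth alpha) (enum_tuple J).

Definition cond_i (n k : nat) (alpha : n.-tuple nat) (p : nat) : Prop :=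
  Some (p - 1) \in park n k [seq a <- alpha | p <= a].

(* Used for p >= 2, as 1 is never in U alpha. *)
Definition cond_ii (n k : nat) (alpha : n.-tuple nat) (p q : nat) : Prop :=
  exists J : {set 'I_n},
    [/\ q - p + 2 <= #|J|,
        forall j, j \in J -> p <= tnth alpha j <= p - 2 + #|J|
      & complete_PF k (shift (p - 2) (restriction alpha J))].

(* Main.v *)
(* In the street restricted to cars of preference at least p, n - p + 2 cars
   compete for the n - p + 1 spots >= p, so everybody can park only if p-1 gets
   occupied; conversely a spot left free splits the street, and counting the
   cars on each side shows that p-1 stays free for some maximal interval.
   For (i) => (ii), take a sequence of cars of preference at least p that fills
   p-1 and is minimal for inclusion. Removing a car moves its hole along the
   street, and the hole can reach p-1 only if, for every i in [p, spot of that
   car], a later car crosses i backward. As a car that crosses i forward forbids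
   later backward crossings of i, the flow across every such i is strictly
   backward, which is completeness. *)
Require Import Defs.
From mathcomp Require Import all_boot all_order all_algebra.
From mathcomp Require Import zify.

Set Implicit Arguments.
Unset Strict Implicit.
Unset Printing Implicit Defensive.

(** * Where a single car parks *)

Lemma ohead_filterP (T : eqType) (R : rel T) (P : pred T) (l : seq T) (s : T) :
  (forall x y, R x y -> ~~ R y x) -> pairwise R l ->
  ohead (filter P l) = Some s <->
  [/\ s \in l, P s & forall x, x \in l -> R x s -> ~~ P x].
Proof.
move=> asymR; elim: l => [|y l IHl] /=; first by split=> [|[]].
case/andP=> /allP yl pl; case: ifP => Py /=.
  split=> [[<-]|[]].
    split; rewrite ?mem_head // => x; rewrite inE => /predU1P[->|/yl /asymR].
      by move=> Ryy; move: (asymR _ _ Ryy); rewrite Ryy.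
    by move=> /negPf->.
  rewrite inE => /predU1P[->//|/yl Rys] _ /(_ y (mem_head _ _) Rys).
  by rewrite Py.
rewrite IHl //; split=> -[sl Ps before_s].
  split; rewrite ?inE ?sl ?orbT // => x.
  by rewrite inE => /predU1P[->|/before_s//]; rewrite Py.
split=> //; first by move: sl Ps; rewrite inE => /predU1P[->|//]; rewrite Py.
by move=> x xl; apply: before_s; rewrite inE xl orbT.
Qed.

(* Only meaningful between candidates of a car of preference [a]. *)
Definition tried_before (a : nat) : rel nat :=
  fun x s => (s < x <= a) || ((a < s) && (x < s)).

Lemma mem_candidates (n k a x : nat) : 1 <= a <= n ->
  (x \in candidates n k a) = (1 <= x <= n) && (a <= x + k).
Proof.
move=> a_in; rewrite /candidates inE mem_cat mem_iota.
have -> : (x \in [seq a - d | d <- iota 1 k & d < a])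
          = (1 <= x < a) && (a <= x + k).
  apply/mapP/idP => [[d]|x_in]; first by rewrite mem_filter mem_iota; lia.
  by exists (a - x); rewrite ?mem_filter ?mem_iota; lia.
by lia.
Qed.

Lemma pairwise_candidates (n k a : nat) :
  pairwise (tried_before a) (candidates n k a).
Proof.
have iota_lt m1 m2 : pairwise ltn (iota m1 m2).
  by rewrite -sorted_pairwise ?iota_ltn_sorted //; apply: ltn_trans.
rewrite /candidates /= pairwise_cat all_cat; apply/and4P; split.
- apply/andP; split; apply/allP => x; last by rewrite mem_iota /tried_before; lia.
  by case/mapP => d; rewrite mem_filter mem_iota /tried_before; lia.
- apply/allrelP => x y /mapP[d]; rewrite mem_filter !mem_iota /tried_before.
  by lia.
- rewrite pairwise_map.
  apply: (@sub_in_pairwise _ (fun d => d < a) ltn); last 2 first.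
  + exact: filter_all.
  + exact/pairwise_filter/iota_lt.
  by move=> d e; rewrite -!topredE /= /tried_before; lia.
- apply: (@sub_in_pairwise _ (fun d => a < d) ltn); last exact: iota_lt.
    by move=> d e; rewrite -!topredE /= /tried_before; lia.
  by apply/allP => x; rewrite mem_iota; lia.
Qed.

(** Trades the candidate list for an order on spots: the chosen spot is free, within reach, and
    everything reachable tried earlier is taken. The bound [a <= x + k] is the backward reach; it
    holds trivially for spots ahead of [a]. *)
Lemma park_carP (n k : nat) (O : seq nat) (a s : nat) : 1 <= a <= n ->
  park_car n k O a = Some s <->
  [/\ s \notin O, 1 <= s <= n, a <= s + k
    & forall x, 1 <= x -> a <= x + k -> tried_before a x s -> x \in O].
Proof.
move=> a_in; rewrite /park_car (@ohead_filterP _ (tried_before a)); last 2 first.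
- by move=> x y; rewrite /tried_before; lia.
- exact: pairwise_candidates.
rewrite mem_candidates //; split=> [[/andP[s_in a_le] s_free before_s]|].
  split=> // x x_gt0 ax x_before; rewrite -[_ \in _]negbK.
  by apply: before_s => //; rewrite mem_candidates //; move: x_before; rewrite /tried_before; lia.
case=> s_free -> -> before_s; split=> // x.
by rewrite mem_candidates // negbK => /andP[/andP[? _] ?]; apply: before_s.
Qed.

Lemma park_car_fail (n k : nat) (O : seq nat) (a x : nat) : 1 <= a <= n ->
  park_car n k O a = None -> 1 <= x <= n -> a <= x + k -> x \in O.
Proof.
move=> a_in fail x_in ax; apply/negPn/negP => x_free.
have: x \in [seq s <- candidates n k a | s \notin O].
  by rewrite mem_filter x_free mem_candidates // x_in.
by move: fail; rewrite /park_car; case: filter.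
Qed.

(** * Occupied spots after a run of cars, and monotonicity *)

Definition occupy (n k : nat) (O : seq nat) (a : nat) : seq nat :=
  if park_car n k O a is Some s then s :: O else O.

Definition run (n k : nat) (O cars : seq nat) : seq nat :=
  foldl (occupy n k) O cars.

Lemma run_cat (n k : nat) (O l1 l2 : seq nat) :
  run n k O (l1 ++ l2) = run n k (run n k O l1) l2.
Proof. exact: foldl_cat. Qed.

Lemma sub_occupy (n k : nat) (O : seq nat) (a : nat) :
  {subset O <= occupy n k O a}.
Proof.
by move=> x xO; rewrite /occupy; case: park_car => [s|//]; rewrite inE xO orbT.
Qed.

Lemma sub_run (n k : nat) (O l : seq nat) : {subset O <= run n k O l}.
Proof.
by elim: l O => [|a l IHl] O x //= /(@sub_occupy n k O a); apply: IHl.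
Qed.

Lemma mem_park_from (n k : nat) (O l : seq nat) (s : nat) : s \notin O ->
  (Some s \in park_from n k O l) = (s \in run n k O l).
Proof.
elim: l O => [|a l IHl] O sO /=; first by rewrite (negPf sO).
rewrite inE -/(occupy n k O a); have [eq_s|ne_s] := eqVneq.
  by symmetry; apply: sub_run; rewrite /occupy -eq_s mem_head.
apply: IHl; rewrite /occupy; case E: park_car ne_s => [t|//] ne_s.
by rewrite inE (negPf sO) orbF; apply: contraNneq ne_s => ->.
Qed.

(** Each car adds at most one spot, so the final size is the largest possible only if no car
    fails. *)
Lemma all_parked_size (n k : nat) (O l : seq nat) :
  all isSome (park_from n k O l) = (size (run n k O l) == size O + size l).
Proof.
have size_le O' l' : size (run n k O' l') <= size O' + size l'.
  elim: l' O' => [|a l' IHl] O' /=; first by rewrite addn0.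
  by apply: leq_trans (IHl _) _; rewrite /occupy; case: park_car => /=; lia.
elim: l O => [|a l IHl] O /=; first by rewrite addn0 eqxx.
rewrite -/(occupy n k O a) {}IHl /occupy; case: park_car => [s|] /=; first by lia.
by have := size_le O l; lia.
Qed.

(** The choice of [s] depends only on the spots tried before it. If these are taken in [O'] as well,
    the car parks in [s] unless [s] is already occupied there. *)
Lemma park_car_eq_first (n k : nat) (O O' : seq nat) (a s : nat) : 1 <= a <= n ->
  park_car n k O a = Some s ->
  (forall x, 1 <= x -> a <= x + k -> tried_before a x s -> x \in O -> x \in O') ->
  s \in occupy n k O' a.
Proof.
move=> a_in /park_carP-/(_ a_in)[s_free s_in a_s before_s] sub.
have [sO'|s_free'] := boolP (s \in O'); first exact: sub_occupy.
rewrite /occupy (_ : park_car n k O' a = Some s) ?mem_head //.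
by apply/park_carP => //; split=> // x x_gt0 ax xs; apply: (sub x) => //; apply: before_s.
Qed.

Lemma occupy_mono (n k : nat) (O O' : seq nat) (a : nat) : 1 <= a <= n ->
  {subset O <= O'} -> {subset occupy n k O a <= occupy n k O' a}.
Proof.
move=> a_in sub x; rewrite {1}/occupy; case E: park_car => [s|]; last first.
  by move=> /sub; apply: sub_occupy.
rewrite inE => /predU1P[->|/sub]; last exact: sub_occupy.
by apply: park_car_eq_first E _ => // y _ _ _; apply: sub.
Qed.

Lemma run_mono (n k : nat) (O O' l l' : seq nat) :
  all (fun a => 1 <= a <= n) l' -> subseq l l' -> {subset O <= O'} ->
  {subset run n k O l <= run n k O' l'}.
Proof.
elim: l' l O O' => [|a l' IHl'] l O O' /=.
  by move=> _ /eqP-> sub.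
case/andP=> a_in l'_in; case: l => [|b l] /=.
  by move=> _ sub x /sub /(@sub_occupy n k _ a); apply: sub_run.
case: eqP => [->|_] sub_l sub.
  by apply: IHl' => //; apply: occupy_mono.
by apply: (IHl' (b :: l)) => // x /sub; apply: sub_occupy.
Qed.

(** A car fails only when all the spots it can reach are taken; they are then also taken in the
    larger occupation, where it would fail too. *)
Lemma all_parked_subseq (n k : nat) (O O' l l' : seq nat) :
  all (fun a => 1 <= a <= n) l' -> subseq l l' -> {subset O <= O'} ->
  all isSome (park_from n k O' l') -> all isSome (park_from n k O l).
Proof.
elim: l' l O O' => [|a l' IHl'] l O O' /=; first by move=> _ /eqP->.
case/andP=> a_in l'_in; case: l => [|b l] //=.
rewrite -/(occupy n k O' a) -/(occupy n k O b).
case: eqP => [->|_] sub_l sub /andP[a_parks l'_park]; last first.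
  apply: (IHl' (b :: l) O (occupy n k O' a)) => // x /sub.
  exact: sub_occupy.
rewrite (IHl' l _ (occupy n k O' a)) ?andbT //; last exact: occupy_mono.
case E: (park_car n k O a) => [//|]; move: a_parks.
case E': park_car => [s|//] _; case/park_carP: E' => // s_free s_in a_s _.
by rewrite (sub _ (park_car_fail a_in E s_in a_s)) in s_free.
Qed.

Lemma run_uniq (n k : nat) (O l : seq nat) :
  all (fun a => 1 <= a <= n) l -> uniq O -> uniq (run n k O l).
Proof.
elim: l O => [//|a l IHl] O /= /andP[a_in l_in] uniqO; apply: IHl => //.
rewrite /occupy; case E: park_car => [s|//] /=; rewrite uniqO andbT.
by case/park_carP: E.
Qed.

Lemma mem_run (n k : nat) (O l : seq nat) (s : nat) :
  s \in run n k O l ->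
  s \in O \/
  exists l1 a l2, l = l1 ++ a :: l2 /\ park_car n k (run n k O l1) a = Some s.
Proof.
elim: l O => [|a l IHl] O /=; first by left.
case/IHl=> [|[l1 [b [l2 [-> Eb]]]]]; last by right; exists (a :: l1), b, l2.
rewrite /occupy; case E: park_car => [t|] sO; last by left.
move: sO; rewrite inE => /predU1P[->|]; last by left.
by right; exists [::], a, l.
Qed.

Lemma run_parked (n k : nat) (O l1 : seq nat) (a : nat) (l2 : seq nat) (s : nat) :
  park_car n k (run n k O l1) a = Some s -> s \in run n k O (l1 ++ a :: l2).
Proof. by move=> E; rewrite run_cat /=; apply: sub_run; rewrite /occupy E mem_head. Qed.

Lemma run_prefix (n k : nat) (O l1 l2 : seq nat) :
  {subset run n k O l1 <= run n k O (l1 ++ l2)}.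
Proof. by rewrite run_cat; apply: sub_run. Qed.

(** * Free spots as barriers, and counting cars against spots *)

(** A spot free at the end was free all along, so a car backing up to it would have stopped there
    instead of passing it. *)
Lemma free_barrier_back (n k : nat) (O l1 : seq nat) (a : nat) (l2 : seq nat) (s j : nat) :
  1 <= a <= n -> park_car n k (run n k O l1) a = Some s ->
  1 <= j -> j \notin run n k O (l1 ++ a :: l2) -> j <= a -> j < s.
Proof.
move=> a_in E j_gt0 j_free ja.
have := run_parked l2 E; case/park_carP: E => // _ s_in a_s before_s sR.
rewrite ltn_neqAle; apply/andP; split.
  by apply: contraNneq j_free => ->.
rewrite leqNgt; apply: contraNN j_free => sj.
by apply/run_prefix/before_s; rewrite /tried_before; lia.
Qed.

Lemma free_barrier_front (n k : nat) (O l1 : seq nat) (a : nat) (l2 : seq nat) (s j : nat) :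
  1 <= a <= n -> park_car n k (run n k O l1) a = Some s ->
  j \notin run n k O (l1 ++ a :: l2) -> a < j -> s < j.
Proof.
move=> a_in E j_free aj.
have := run_parked l2 E; case/park_carP: E => // _ s_in a_s before_s sR.
rewrite ltn_neqAle; apply/andP; split.
  by apply: contraNneq j_free => <-.
rewrite leqNgt; apply: contraNN j_free => sj.
by apply/run_prefix/before_s; rewrite /tried_before; lia.
Qed.

(** This lemma and the next charge each parked car to the new spot it takes, turning a relation
    between preferences and parking spots into an inequality between counts. *)
Lemma count_run_ge (n k : nat) (O l : seq nat) (P Q : pred nat) :
  (forall l1 a l2, l = l1 ++ a :: l2 -> P a ->
     exists2 s, park_car n k (run n k O l1) a = Some s & Q s) ->
  count P l + count Q O <= count Q (run n k O l).
Proof.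
elim: l O => [//|a l IHl] O parks /=.
have {}IHl : count P l + count Q (occupy n k O a) <= count Q (run n k (occupy n k O a) l).
  by apply: IHl => l1 b l2 El; apply: (parks (a :: l1) b l2); rewrite El.
apply: leq_trans IHl; case Pa: (P a) => /=.
  have [s /= E Qs] := parks [::] a l erefl Pa.
  by rewrite /occupy E /= Qs; lia.
by rewrite leq_add2l /occupy; case: park_car => //= s; rewrite leq_addl.
Qed.

Lemma count_run_le (n k : nat) (O l : seq nat) (P Q : pred nat) :
  (forall l1 a l2 s, l = l1 ++ a :: l2 ->
     park_car n k (run n k O l1) a = Some s -> Q s -> P a) ->
  count Q (run n k O l) <= count P l + count Q O.
Proof.
elim: l O => [//|a l IHl] O parks /=.
apply: leq_trans (IHl _ _) _.
  by move=> l1 b l2 s El; apply: (parks (a :: l1) b l2); rewrite El.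
have := parks [::] a l _ erefl; rewrite /= /occupy.
case: park_car => [s|_] /=; last by lia.
by move=> /(_ s erefl); case: (Q s) => [->|] //=; lia.
Qed.

Lemma count_interval_le (l : seq nat) (x y : nat) :
  uniq l -> count (fun s => x <= s < y) l <= y - x.
Proof.
move=> ul; rewrite -size_filter -(size_iota x (y - x)).
apply: uniq_leq_size; first exact: filter_uniq.
by move=> s; rewrite mem_filter mem_iota; lia.
Qed.

Lemma leq_count_interval (l : seq nat) (P : pred nat) (x y : nat) :
  (forall s, x <= s < y -> (s \in l) && P s) -> y - x <= count P l.
Proof.
move=> full; rewrite -size_filter -(size_iota x (y - x)).
apply: uniq_leq_size; first exact: iota_uniq.
move=> s; rewrite mem_iota mem_filter => s_in.
by have/andP[-> ->] := full s ltac:(lia).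
Qed.

(** A car with preference below [i] that parks below [i] has tried only spots below [i] before.
    Hence what happens at or above [i] can influence the spots below [i] only through a car crossing
    [i] backward. *)
Lemma run_agree_or_cross (n k i : nat) (O O' l : seq nat) :
  all (fun a => 1 <= a <= n) l ->
  (forall x, x < i -> x \in O -> x \in O') ->
  (forall x, x < i -> x \in run n k O l -> x \in run n k O' l) \/
  exists l1 b l2 s,
    [/\ l = l1 ++ b :: l2, park_car n k (run n k O l1) b = Some s & s < i <= b].
Proof.
elim: l O O' => [|a l IHl] O O' /=; first by left.
case/andP=> a_in l_in sub.
have lift_right : (exists l1 b l2 s,
    [/\ l = l1 ++ b :: l2, park_car n k (run n k (occupy n k O a) l1) b = Some s & s < i <= b]) ->
   exists l1 b l2 s,
    [/\ a :: l = l1 ++ b :: l2, park_car n k (run n k O l1) b = Some s & s < i <= b].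
  by case=> l1 [b [l2 [s [-> E sb]]]]; exists (a :: l1), b, l2, s.
case E: (park_car n k O a) => [s|]; last first.
  case: (IHl (occupy n k O a) (occupy n k O' a)) => //; last 2 first.
  - by left.
  - by right; apply: lift_right.
  by rewrite /occupy E => x xi /(sub _ xi); apply: sub_occupy.
have [s_lt|s_ge] := boolP (s < i <= a).
  by right; exists [::], a, l, s.
case: (IHl (occupy n k O a) (occupy n k O' a)) => //; last 2 first.
- by left.
- by right; apply: lift_right.
rewrite {1}/occupy E => x xi; rewrite inE => /predU1P[xs|/(sub _ xi)]; last exact: sub_occupy.
rewrite xs in xi *; apply: park_car_eq_first E _ => // y y_gt0 ay ys; apply: sub.
by move: ys; rewrite /tried_before; lia.
Qed.

(** * Excess and maximal intervals *)

Lemma count_add_le (P Q R : pred nat) (l : seq nat) :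
  (forall a, P a + Q a <= R a) -> count P l + count Q l <= count R l.
Proof. by move=> PQR; elim: l => //= a l; have := PQR a; lia. Qed.

Lemma count_le_add (P Q R : pred nat) (l : seq nat) :
  (forall a, R a <= P a + Q a) -> count R l <= count P l + count Q l.
Proof. by move=> PQR; elim: l => //= a l; have := PQR a; lia. Qed.

Lemma sum_count_mem (s : seq nat) (x y : nat) :
  \sum_(x <= i < y) count_mem i s = count (fun a => x <= a < y) s.
Proof.
elim: s => [|a s IHs] /=; first by rewrite big1.
rewrite big_split /= IHs; congr (_ + _).
rewrite (_ : \sum_(x <= i < y) (a == i) = count_mem a (index_iota x y)).
  by rewrite count_uniq_mem ?iota_uniq // mem_index_iota.
by rewrite -sum1_count [RHS]big_mkcond /=; apply: eq_bigr => i _; rewrite eq_sym; case: eqP.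
Qed.

Lemma mem_U (n : nat) (alpha : n.-tuple nat) (j : nat) : PP alpha ->
  U alpha j = (1 <= j <= n) && (n + 2 <= count (leq j) alpha + j).
Proof.
move=> /allP alphaP; rewrite /U /excess sum_count_mem.
have -> : count (fun a => j <= a < n.+1) alpha = count (leq j) alpha.
  by apply: eq_in_count => a /alphaP; lia.
by case: (boolP (1 <= j <= n)) => //= _; lia.
Qed.

Lemma exists_maximal_interval (n : nat) (A : pred nat) (j : nat) :
  (forall i, A i -> i <= n) -> A j ->
  exists p q, maximal_interval A p q /\ p <= j <= q.
Proof.
move=> A_le Aj.
pose up q := (j <= q) && all A (iota j (q - j).+1).
pose down p := (p <= j) && all A (iota p (j - p).+1).
have upP q : reflect (j <= q /\ forall i, j <= i <= q -> A i) (up q).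
  apply: (iffP andP) => -[jq Ajq]; split=> //.
    by move=> i i_in; apply: (allP Ajq); rewrite mem_iota; lia.
  by apply/allP => i; rewrite mem_iota => i_in; apply: Ajq; lia.
have downP p : reflect (p <= j /\ forall i, p <= i <= j -> A i) (down p).
  apply: (iffP andP) => -[pj Apj]; split=> //.
    by move=> i i_in; apply: (allP Apj); rewrite mem_iota; lia.
  by apply/allP => i; rewrite mem_iota => i_in; apply: Apj; lia.
have only_j i : j <= i <= j -> A i by move=> i_in; rewrite (_ : i = j) //; lia.
have up_j : exists q, up q by exists j; apply/upP.
have down_j : exists p, down p by exists j; apply/downP.
have up_le q : up q -> q <= n by case/upP => jq Ajq; apply/A_le/Ajq; lia.
case: (ex_maxnP up_j up_le) => q /upP[jq Ajq] q_max.
case: (ex_minnP down_j) => p /downP[pj Apj] p_min.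
exists p, q; split; last by rewrite pj.
split; first split; first by lia.
  by move=> i i_in; case: (leqP i j) => ij; [apply: Apj|apply: Ajq]; lia.
move=> p' q' [_ Apq'] p'p qq'.
have p_le : p <= p' by apply/p_min/downP; split=> [|i i_in]; [lia|apply: Apq'; lia].
have q_ge : q' <= q by apply/q_max/upP; split=> [|i i_in]; [lia|apply: Apq'; lia].
by lia.
Qed.

(** One step to the left lowers the excess by at most 1, and [p - 1] has excess at most 0; so the
    excess at [p] is exactly 1, that is, exactly [n - p + 2] cars prefer a spot at least [p]. The
    last bound says that the excess is at most 0 at [q + 1], or that [q = n]. *)
Lemma maximal_interval_bounds (n : nat) (alpha : n.-tuple nat) (p q : nat) :
  PP alpha -> maximal_interval (U alpha) p q ->
  [/\ 2 <= p, p <= q <= n,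
      forall j, p <= j <= q -> n + 2 <= count (leq j) alpha + j,
      count (leq p) alpha + p = n + 2
    & count (leq q.+1) alpha + q <= n].
Proof.
move=> alphaP [[pq Upq] pq_max].
have count_le j : count (leq j) alpha <= n.
  by rewrite -{2}(size_tuple alpha) count_size.
have Upq' j : p <= j <= q -> (1 <= j <= n) && (n + 2 <= count (leq j) alpha + j).
  by move=> /Upq; rewrite mem_U.
have p_ge2 : 2 <= p by have := Upq' p ltac:(lia); have := count_le p; lia.
have q_le := Upq' q ltac:(lia).
split=> //; first by lia.
- by move=> j /Upq' /andP[].
- have /negbTE : ~~ U alpha p.-1.
    apply/negP => Up; have [] : p.-1 = p /\ q = q; last by lia.
    apply: pq_max; [split; first by lia|by lia|by []].
    move=> j j_in; case: (leqP p j) => pj; first by apply: Upq; lia.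
    by rewrite (_ : j = p.-1) //; lia.
  rewrite mem_U //.
  have : count (leq p) alpha <= count (leq p.-1) alpha.
    by apply: sub_count => a /=; lia.
  by have := Upq' p ltac:(lia); lia.
have [->|q_lt] := eqVneq q n.
  rewrite (_ : count _ _ = 0) //; apply/eqP; rewrite -leqn0 leqNgt -has_count.
  by apply/hasPn => a /(allP alphaP); lia.
have /negbTE : ~~ U alpha q.+1.
  apply/negP => Uq; have [] : p = p /\ q.+1 = q; last by lia.
  apply: pq_max; [split; first by lia|by []|by []].
  move=> j j_in; case: (leqP j q) => jq; first by apply: Upq; lia.
  by rewrite (_ : j = q.+1) //; lia.
by rewrite mem_U //; lia.
Qed.

(** * Condition (i) and parking functions *)

Lemma sub_all_filter (T : eqType) (P Q : pred T) (l : seq T) :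
  all P l -> all P (filter Q l).
Proof. by move=> /allP Pl; apply/allP => x; rewrite mem_filter => /andP[_ /Pl]. Qed.

Lemma cond_iE (n k : nat) (alpha : n.-tuple nat) (p : nat) :
  cond_i k alpha p <-> p - 1 \in run n k [::] [seq a <- alpha | p <= a].
Proof. by rewrite /cond_i /park mem_park_from. Qed.

Lemma mem_run_range (n k : nat) (l : seq nat) (s : nat) :
  all (fun a => 1 <= a <= n) l -> s \in run n k [::] l -> 1 <= s <= n.
Proof.
move=> l_in /mem_run[//|[l1 [a [l2 [El E]]]]].
by move: l_in; rewrite El all_cat /= => /and3P[_ /park_carP-/(_ _ _ _)/(iffLR)/(_ E)[]].
Qed.

(** At least [q - p + 2] cars prefer a spot of [[p, q]], and all of them reach back to [p - 1]. Were
    [p - 1] to stay free, none of them would fail or move forward, so all would park in the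
    [q - p + 1] spots of [[p, q]]. *)
Lemma small_interval_cond_i (n k : nat) (alpha : n.-tuple nat) (p q : nat) :
  PP alpha -> maximal_interval (U alpha) p q -> q - p + 1 <= k -> cond_i k alpha p.
Proof.
move=> alphaP pq_max small; apply/cond_iE.
have [p_ge2 pq _ count_p count_q] := maximal_interval_bounds alphaP pq_max.
set L := filter _ _; have L_in : all (fun a => 1 <= a <= n) L by apply: sub_all_filter.
apply/negPn/negP => p_free.
have : q.+1 - p < count (fun a => p <= a < q.+1) L.
  rewrite count_filter; set c := count _ _.
  suff : count (leq p) alpha <= c + count (leq q.+1) alpha by lia.
  by apply: count_le_add => a /=; lia.
rewrite ltnNge => /negP; apply.
apply: leq_trans (count_interval_le p q.+1 (run_uniq k L_in (isT : uniq [::]))).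
rewrite -[leqLHS]addn0; apply: (count_run_ge (O := [::])) => l1 a l2 El /= a_in.
have a_le : 1 <= a <= n by move: L_in; rewrite El all_cat /= => /and3P[].
have p_free1 : p - 1 \notin run n k [::] l1.
  by apply: contraNN p_free; rewrite El; apply: run_prefix.
case E: park_car => [s|]; last first.
  by case/negP: p_free1; apply: (park_car_fail a_le E); lia.
exists s => //=; rewrite El in p_free.
have ps : p - 1 < s by apply: (free_barrier_back a_le E _ p_free); lia.
case/(park_carP _ _ _ a_le): E => s_free s_in a_s before_s.
have [sa|sa] := leqP s a; first by lia.
by case/negP: p_free1; apply: before_s; rewrite /tried_before; lia.
Qed.

Lemma preferred_occupied (n k : nat) (O l : seq nat) (a : nat) :
  all (fun b => 1 <= b <= n) l -> a \in l -> a \in run n k O l.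
Proof.
move=> l_in al; case/splitPr: al l_in => l1 l2; rewrite all_cat /= => /and3P[_ a_in _].
case E: (park_car n k (run n k O l1) a) => [s|]; last first.
  by apply/run_prefix/(park_car_fail a_in E); lia.
have [sa|sa] := eqVneq s a; first by rewrite -{1}sa; apply: run_parked E.
case/(park_carP _ _ _ a_in): E => _ _ _ before_s.
by apply/run_prefix/before_s; rewrite /tried_before; lia.
Qed.

Lemma size_all_parked_le (n k : nat) (l : seq nat) (x y : nat) :
  all (fun a => 1 <= a <= n) l -> all isSome (park n k l) ->
  (forall s, s \in run n k [::] l -> x <= s < y) -> size l <= y - x.
Proof.
move=> l_in; rewrite all_parked_size add0n => /eqP <- run_in.
have /eqP <- : count (fun s => x <= s < y) (run n k [::] l) == size (run n k [::] l).
  by rewrite -all_count; apply/allP.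
exact: count_interval_le x y (run_uniq k l_in (isT : uniq [::])).
Qed.

(** The cars of preference at least [p] still all park when run alone. If [p - 1] stayed free, it
    would confine these [n - p + 2] cars to the [n - p + 1] spots of [[p, n]]. *)
Lemma PF_cond_i (n k : nat) (alpha : n.-tuple nat) (p q : nat) :
  PF k alpha -> maximal_interval (U alpha) p q -> cond_i k alpha p.
Proof.
case/andP=> alphaP parked pq_max; apply/cond_iE.
have [p_ge2 pq _ count_p _] := maximal_interval_bounds alphaP pq_max.
set L := filter _ _; have L_in : all (fun a => 1 <= a <= n) L by apply: sub_all_filter.
apply/negPn/negP => p_free.
have L_parked : all isSome (park n k L).
  by apply: (all_parked_subseq (O' := [::]) alphaP _ _ parked); first exact: filter_subseq.
have: size L <= n.+1 - p.
  apply: (size_all_parked_le L_in L_parked) => s sL.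
  have := mem_run_range L_in sL.
  case/mem_run: (sL) => [//|[l1 [a [l2 [El E]]]]] s_in.
  have a_le : 1 <= a <= n by move: L_in; rewrite El all_cat /= => /and3P[].
  have pa : p <= a.
    by move: (filter_all (leq p) alpha); rewrite -/L El all_cat /= => /and3P[].
  rewrite El in p_free.
  by have : p - 1 < s; [apply: (free_barrier_back a_le E _ p_free)|]; lia.
by have -> : size L = count (leq p) alpha; [exact: size_filter|lia].
Qed.

(** If some car fails, a spot [j] stays free. Too many cars then prefer a spot beyond [j], so
    [j + 1] lies in a maximal interval [[p, q]]; the first free spot of the run restricted to
    preferences at least [p] contradicts the excess there. *)
Lemma cond_i_PF (n k : nat) (alpha : n.-tuple nat) :
  PP alpha ->
  (forall p q, maximal_interval (U alpha) p q -> cond_i k alpha p) -> PF k alpha.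
Proof.
move=> alphaP all_i; rewrite /PF alphaP /= all_parked_size add0n size_tuple.
have run_in := mem_run_range alphaP (k := k).
have uniq_run := run_uniq k alphaP (isT : uniq [::]).
apply/negPn/negP => not_full.
have [j] : exists j, (1 <= j <= n) && (j \notin run n k [::] alpha).
  have [/allP full|/allPn[j]] := boolP (all (mem (run n k [::] alpha)) (iota 1 n)); last first.
    by rewrite mem_iota => j_in j_free; exists j; apply/andP; split; [lia|].
  case/eqP: not_full; transitivity (size (iota 1 n)); last exact: size_iota.
  apply/eqP; rewrite eqn_leq uniq_leq_size //=; last first.
    by move=> s /run_in; rewrite mem_iota; lia.
  exact: uniq_leq_size (iota_uniq _ _) full.
case/andP=> j_in j_free.
(* Cars preferring a spot left of [j] neither fail nor pass the free spot [j], so they share [j - 1]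
   spots. *)
have count_lt : count (fun a => a < j) alpha <= j - 1.
  apply: leq_trans (count_interval_le 1 j uniq_run).
  rewrite -[leqLHS]addn0; apply: (count_run_ge (O := [::])) => l1 a l2 El aj.
  have a_le : 1 <= a <= n by move: alphaP; rewrite /PP El all_cat /= => /and3P[].
  case E: park_car => [s|]; last first.
    case/negP: j_free; rewrite El; apply/run_prefix/(park_car_fail a_le E); lia.
  exists s => //; rewrite El in j_free; rewrite (free_barrier_front a_le E j_free aj).
  by case/(park_carP _ _ _ a_le): E; lia.
have no_j : count_mem j alpha = 0.
  by apply/count_memPn; apply: contraNN j_free; apply: preferred_occupied.
have count_gt : n - j < count (leq j.+1) alpha.
  have : size alpha <= count (fun a => a <= j) alpha + count (leq j.+1) alpha.
    by rewrite -count_predT; apply: count_le_add => a /=; lia.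
  have : count (fun a => a <= j) alpha <= count (fun a => a < j) alpha + count_mem j alpha.
    by apply: count_le_add => a /=; lia.
  by rewrite no_j size_tuple; lia.
have j_lt : j < n.
  rewrite ltn_neqAle (andP j_in).2 andbT; apply: contraTneq count_gt => ->.
  rewrite subnn -leqNgt leqn0 -[_ == 0]negbK -lt0n -has_count; apply/hasPn => a /(allP alphaP).
  by lia.
have Uj : U alpha j.+1 by rewrite mem_U //; lia.
have U_le i : U alpha i -> i <= n by rewrite mem_U //; lia.
have [p [q [pq_max pq_j]]] := exists_maximal_interval U_le Uj.
have [p_ge2 pq U_pq count_p count_q] := maximal_interval_bounds alphaP pq_max.
have /cond_iE := all_i p q pq_max.
set L := filter _ _ => p_occ.
have L_in : all (fun a => 1 <= a <= n) L by apply: sub_all_filter.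
have j_freeL : j \notin run n k [::] L.
  apply: contraNN j_free; apply: run_mono => //; exact: filter_subseq.
have free_ex : exists i, (p <= i) && (i \notin run n k [::] L).
  exists j; rewrite j_freeL andbT leqNgt; apply: contraNN j_freeL => jp.
  by rewrite (_ : j = p - 1) //; lia.
(* Since [i <= j < q], the first free spot [i] lies in [[p, q]] and must have positive excess. *)
case: (ex_minnP free_ex) => i /andP[pi i_free] i_min.
have ij : i <= j.
  apply: i_min; rewrite j_freeL andbT leqNgt; apply: contraNN j_freeL => jp.
  by rewrite (_ : j = p - 1) //; lia.
(* The spots from [p - 1] to [i - 1] are all taken, by cars with preference below [i] since no car
   backs past [i]. This leaves at most [n + 1 - i] preferences from [i] on, so the excess at [i] is
   at most 0. *)
have: i - (p - 1) <= count (fun a => a < i) L.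
  have full s : p - 1 <= s < i -> (s \in run n k [::] L) && (s < i).
    move=> s_in; apply/andP; split; last by lia.
    have [->//|sp] := eqVneq s (p - 1).
    by apply/negPn/negP => s_free; have := i_min s; rewrite s_free andbT; lia.
  apply: leq_trans (leq_count_interval full) _.
  rewrite -[leqRHS]addn0; apply: (count_run_le (O := [::])) => l1 a l2 s El E si.
  rewrite ltnNge; apply/negP => ia; rewrite El in i_free.
  have a_le : 1 <= a <= n by move: L_in; rewrite El all_cat /= => /and3P[].
  by have : i < s; [apply: (free_barrier_back a_le E _ i_free)|]; lia.
suff : count (fun a => a < i) L + count (leq i) alpha <= count (leq p) alpha.
  by have := U_pq i ltac:(lia); lia.
by rewrite count_filter; apply: count_add_le => a /=; lia.
Qed.

(** * Minimal sequences of cars filling a given spot *)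

Lemma minimal_subseq (n k x : nat) (l : seq nat) :
  x \in run n k [::] l ->
  exists l', [/\ subseq l' l, x \in run n k [::] l'
    & forall l1 a l2, l' = l1 ++ a :: l2 -> x \notin run n k [::] (l1 ++ l2)].
Proof.
have [m] := ubnP (size l); elim: m l => // m IHm l l_lt x_occ.
have [/hasP[i]|/hasPn minimal] := boolP (has
  (fun i => x \in run n k [::] (take i l ++ drop i.+1 l)) (iota 0 (size l))).
  rewrite mem_iota /= => i_lt x_occ'.
  have sub : subseq (take i l ++ drop i.+1 l) l.
    rewrite -[X in subseq _ X](cat_take_drop i) cat_subseq //.
    by rewrite [X in subseq _ X](drop_nth 0) // subseq_cons.
  have [|l' [sub' x_occ'' min']] := IHm _ _ x_occ'.
    by rewrite size_cat size_take size_drop; case: ifP; lia.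
  by exists l'; split=> //; apply: subseq_trans sub' sub.
exists l; split=> // l1 a l2 El; have := minimal (size l1).
rewrite mem_iota El size_cat /= take_size_cat //.
have -> : drop (size l1).+1 (l1 ++ a :: l2) = l2.
  by rewrite drop_cat ltnNge leqnSn subSnn /= drop0.
by apply; lia.
Qed.

(** Applied with [x = p - 1]. The cars turn out to fill exactly the block from [x] to the spot
    before [j], the first free spot above [x], so [j = x + size l]. The last conclusion is
    completeness, once spots are translated by [x - 1]. *)
Lemma minimal_complete (n k x : nat) (l : seq nat) :
  all (fun a => (0 < x) && (x < a <= n)) l -> x \in run n k [::] l ->
  (forall l1 a l2, l = l1 ++ a :: l2 -> x \notin run n k [::] (l1 ++ l2)) ->
  [/\ all (fun a => a < x + size l) l,
      forall l1 a l2, l = l1 ++ a :: l2 ->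
        exists2 s, park_car n k (run n k [::] l1) a = Some s & x <= s < x + size l
    & forall i, x < i < x + size l -> x + size l - i < count (leq i) l].
Proof.
move=> l_gt x_occ minimal.
have l_in : all (fun a => 1 <= a <= n) l.
  by apply: sub_all l_gt => a /=; lia.
have car_in l1 a l2 : l = l1 ++ a :: l2 -> (0 < x) && (x < a <= n).
  by move=> El; move: l_gt; rewrite El all_cat /= => /and3P[].
have car_in' l1 a l2 : l = l1 ++ a :: l2 -> 1 <= a <= n.
  by move=> /car_in; lia.
(* By minimality [x] stays free until the last car. *)
have x_late l1 a l2 : l = l1 ++ a :: l2 -> x \notin run n k [::] l1.
  by move=> /minimal; apply: contraNN; apply: run_prefix.
(* A failing car could be removed without effect, and a car backing past [x] would have found [x]
   taken too early. *)
have parks l1 a l2 : l = l1 ++ a :: l2 ->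
    exists2 s, park_car n k (run n k [::] l1) a = Some s & x <= s.
  move=> El; case E: park_car => [s|]; last first.
    by case/negP: (minimal _ _ _ El); move: x_occ; rewrite El !run_cat /= /occupy E.
  exists s => //; rewrite leqNgt; apply: contraNN (x_late _ _ _ El) => sx.
  case/(park_carP _ _ _ (car_in' _ _ _ El)): E => _ s_in a_s before_s.
  by have := car_in _ _ _ El => a_in; apply: before_s; rewrite /tried_before; lia.
(* Compare the runs with and without the car parked in [s]. Their occupations agree below [i] just
   after it; unless a later car crosses [i] backward, [x] would also be filled without it. *)
have crossed l1 a l2 s i : l = l1 ++ a :: l2 ->
    park_car n k (run n k [::] l1) a = Some s -> x < i <= s ->
    exists l3 b l4 s', [/\ l2 = l3 ++ b :: l4,
      park_car n k (run n k [::] (l1 ++ a :: l3)) b = Some s' & s' < i <= b].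
  move=> El E i_in.
  have l2_in : all (fun a => 1 <= a <= n) l2.
    by move: l_in; rewrite El all_cat /= => /and3P[].
  have [|same_below|[l3 [b [l4 [s' [El2 E' s'b]]]]]] :=
      @run_agree_or_cross n k i (s :: run n k [::] l1) (run n k [::] l1) l2 l2_in.
  - by move=> y yi; rewrite inE => /predU1P[|//]; lia.
  - case/negP: (minimal _ _ _ El); rewrite run_cat; apply: same_below; first by lia.
    by move: x_occ; rewrite El run_cat /= /occupy E.
  by exists l3, b, l4, s'; split=> //; rewrite run_cat /= /occupy E.
have x_in := mem_run_range l_in x_occ.
have free_ex : exists j, (x < j) && (j \notin run n k [::] l).
  (* Spot [n + 1] is off the street, hence never occupied. *)
  exists n.+1; apply/andP; split; first by lia.
  by apply/negP => /(mem_run_range l_in); lia.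
case: (ex_minnP free_ex) => j /andP[xj j_free] j_min.
have full s : x <= s < j -> s \in run n k [::] l.
  move=> s_in; have [->//|sx] := eqVneq s x.
  by apply/negPn/negP => s_free; have := j_min s; rewrite s_free andbT; lia.
(* A car parking at [j] or beyond would force a later car to cross the free spot [j] backward. *)
have parks_in l1 a l2 s : l = l1 ++ a :: l2 ->
    park_car n k (run n k [::] l1) a = Some s -> s < j.
  move=> El E; rewrite ltnNge; apply/negP => js.
  have [|l3 [b [l4 [s' [El2 E' s'b]]]]] := crossed _ _ _ _ j El E; first by lia.
  have El' : l = (l1 ++ a :: l3) ++ b :: l4 by rewrite El El2 -catA.
  move: (j_free); rewrite El' => j_free'.
  by have : j < s'; [apply: (free_barrier_back (car_in' _ _ _ El') E' _ j_free')|]; lia.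
have size_l : x + size l = j.
  have : size l <= j - x.
    apply: leq_trans (count_interval_le x j (run_uniq k l_in (isT : uniq [::]))).
    rewrite -count_predT -[leqLHS]addn0; apply: (count_run_ge (O := [::])) => l1 a l2 El _.
    have [s E xs] := parks _ _ _ El; exists s => //.
    by rewrite xs (parks_in _ _ _ _ El E).
  have : j - x <= size l.
    apply: leq_trans (@leq_count_interval (run n k [::] l) predT x j _) _.
      by move=> s /full ->.
    rewrite -(count_predT l) -[leqRHS]addn0; exact: (count_run_le (O := [::])).
  by lia.
rewrite size_l; split.
- apply/allP => a al; have [l1 [l2 El]] : exists l1 l2, l = l1 ++ a :: l2.
    by case/splitPr: al => l1 l2; exists l1, l2.
  have [s E _] := parks _ _ _ El; have := parks_in _ _ _ _ El E.
  rewrite ltnNge => sj; rewrite ltnNge; apply: contraNN sj => ja.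
  move: (j_free); rewrite El => j_free'.
  by apply/ltnW/(free_barrier_back (car_in' _ _ _ El) E _ j_free'); lia.
- move=> l1 a l2 El; have [s E xs] := parks _ _ _ El.
  by exists s; rewrite ?xs ?(parks_in _ _ _ _ El E).
move=> i i_in.
(* A car crossing [i] forward leaves its [k] spots below [i] occupied, so no
   later car can cross [i] backward. *)
have no_forward l1 a l2 s : l = l1 ++ a :: l2 ->
    park_car n k (run n k [::] l1) a = Some s -> i <= s -> i <= a.
  move=> El E is_; rewrite leqNgt; apply/negP => ai.
  have [|l3 [b [l4 [s' [El2 E' s'b]]]]] := crossed _ _ _ _ i El E; first by lia.
  have El' : l = (l1 ++ a :: l3) ++ b :: l4 by rewrite El El2 -catA.
  case/(park_carP _ _ _ (car_in' _ _ _ El')): E' => s'_free s'_in b_s' _.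
  case/(park_carP _ _ _ (car_in' _ _ _ El)): E => _ s_in a_s before_s.
  by case/negP: s'_free; apply/run_prefix/before_s; rewrite /tried_before; lia.
(* The car filling [i] forces a later car [b] to cross [i] backward. The [j - i] spots from [i] on
   are filled by cars of preference at least [i] other than [b]; splitting the run at [b] counts it
   separately and makes the inequality strict. *)
have [//|[l1 [a [l2 [El E]]]]] := mem_run (full i ltac:(lia)).
have [|l3 [b [l4 [s [El2 E' sb]]]]] := crossed _ _ _ _ i El E; first by lia.
set m1 := l1 ++ a :: l3 in E'.
have {El2}El' : l = m1 ++ b :: l4 by rewrite El El2 /m1 -catA.
have run_l : run n k [::] l = run n k (s :: run n k [::] m1) l4.
  by rewrite El' run_cat /= /occupy E'.
have : j - i <= count (leq i) (run n k [::] l).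
  by apply: leq_count_interval => t t_in; rewrite full; lia.
have : count (leq i) (run n k (s :: run n k [::] m1) l4)
       <= count (leq i) l4 + count (leq i) (s :: run n k [::] m1).
  apply: count_run_le => l1' c l2' t El4 Et; apply: (no_forward (m1 ++ b :: l1') c l2').
    by rewrite El' El4 -catA.
  by rewrite run_cat /= /occupy E'.
have : count (leq i) (run n k [::] m1) <= count (leq i) m1 + count (leq i) [::].
  apply: count_run_le => l1' c l2' t Em1; apply: (no_forward l1' c (l2' ++ b :: l4)).
  by rewrite El' Em1 -catA.
by rewrite run_l El' count_cat /=; lia.
Qed.

(** * Translating a street of length [h] into a longer one *)

(** The long street differs by the spots up to [w] and those beyond [w + h]. As long as [w + 1] is
    free, no car of [l] backs past it into the former, so the long street gets at least the
    translated spots. *)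
Lemma run_shift_sub (n h k w : nat) (O O' l : seq nat) :
  h + w <= n -> all (fun a => 1 <= a <= h) l ->
  w + 1 \notin run n k O' (map (addn w) l) ->
  (forall x, x \in O -> w + x \in O') ->
  forall x, x \in run h k O l -> w + x \in run n k O' (map (addn w) l).
Proof.
move=> hw; elim: l O O' => [|a l IHl] O O' /=; first by move=> _ _; apply.
case/andP=> a_in l_in w_free sub; apply: IHl => // x; rewrite /(occupy h).
have w_free' : w + 1 \notin occupy n k O' (w + a).
  by apply: contraNN w_free; apply: sub_run.
have w_freeO : w + 1 \notin O' by apply: contraNN w_free'; apply: sub_occupy.
case E: park_car => [s|]; last by move/sub; apply: sub_occupy.
rewrite inE => /predU1P[->|/sub]; last exact: sub_occupy.
case/(park_carP _ _ _ a_in): E => s_free s_in a_s before_s.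
have [/sub_occupy//|s_free'] := boolP (w + s \in O').
have wa_in : 1 <= w + a <= n by lia.
rewrite /occupy (_ : park_car _ _ _ _ = Some (w + s)) ?mem_head //.
apply/park_carP => //; split=> //; [lia|lia|move=> y y_gt0 ay ys].
have [yw|wy] := leqP y w; last first.
  rewrite -(subnKC (ltnW wy)); apply/sub/before_s; [lia|lia|].
  by move: ys; rewrite /tried_before; lia.
(* If a spot [y <= w] is tried before [w + s], the car moves forward, and spot 1 of the short street
   is within its reach. It was then found taken, so [w + 1] would be occupied. *)
case/negP: w_freeO; apply/sub/before_s; [lia|lia|].
by move: ys s_in; rewrite /tried_before; lia.
Qed.

(** When the cars of the long street all park between [w + 1] and [w + h], the short street
    reproduces the same run, since its cars try only translates of spots tried in the long one. *)
Lemma shift_all_parked (n h k w : nat) (O O' l : seq nat) :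
  all (fun a => 1 <= a <= h) l -> all (fun a => 1 <= w + a <= n) l ->
  (forall x, 1 <= x <= h -> (x \in O) = (w + x \in O')) ->
  (forall l1 a l2, map (addn w) l = l1 ++ a :: l2 ->
     exists2 s, park_car n k (run n k O' l1) a = Some s & w < s <= w + h) ->
  all isSome (park_from h k O l).
Proof.
elim: l O O' => [//|a l IHl] O O' /= /andP[a_in l_in] /andP[wa_in l_in'] eqO parks.
have [s /= E s_in] := parks [::] _ _ erefl.
have E' : park_car h k O a = Some (s - w).
  case/(park_carP _ _ _ wa_in): E => s_free s_in' a_s before_s.
  apply/park_carP => //; split; [|lia|lia|move=> x x_gt0 ax xs].
    by rewrite eqO ?subnKC //; lia.
  rewrite eqO; last by move: xs; rewrite /tried_before; lia.
  by apply: before_s; move: xs; rewrite /tried_before; lia.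
rewrite E' /=; apply: (IHl _ (s :: O')) => // [x x_in|l1 b l2 El].
  by rewrite !inE eqO //; congr (_ || _); lia.
have := parks (w + a :: l1) b l2; rewrite El /= /occupy E; exact.
Qed.

Lemma subseq_restriction (n : nat) (alpha : n.-tuple nat) (l : seq nat) :
  subseq l alpha -> exists J : {set 'I_n}, val (restriction alpha J) = l.
Proof.
case/subseqP => m size_m ->; exists [set i in mask m (enum 'I_n)].
rewrite /= -[X in _ = mask _ X](map_tnth_enum alpha) -map_mask; congr map.
rewrite [RHS](mask_filter _ (enum_uniq _)) [X in filter _ X]enumT.
by apply: eq_filter => i; rewrite /= inE.
Qed.

Lemma restriction_subseq (n : nat) (alpha : n.-tuple nat) (J : {set 'I_n}) :
  subseq (restriction alpha J) alpha.
Proof.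
rewrite -[X in subseq _ X]map_tnth_enum map_subseq // [X in subseq _ X]enumT.
exact: filter_subseq.
Qed.

Lemma map_shiftK (w : nat) (l : seq nat) :
  all (leq w) l -> map (addn w) (map (fun a => a - w) l) = l.
Proof.
move=> /allP l_ge; rewrite -map_comp; rewrite -[RHS]map_id.
by apply/eq_in_map => a /l_ge /=; lia.
Qed.

(** * Equivalence of (i) and (ii), and conclusion *)

(** The [h] cars of the shifted parking function fill all [h] spots, spot 1 included, which
    corresponds to [p - 1]. If [p - 1] were free in the long street, [run_shift_sub] would apply and
    put a car there. *)
Lemma cond_ii_i (n k : nat) (alpha : n.-tuple nat) (p q : nat) :
  PP alpha -> maximal_interval (U alpha) p q -> cond_ii k alpha p q -> cond_i k alpha p.
Proof.
move=> alphaP pq_max [J [J_ge J_in [[h_ge2 lP _] /andP[_ parked]]]].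
have [p_ge2 pq _ count_p _] := maximal_interval_bounds alphaP pq_max.
apply/cond_iE; move: J_ge lP h_ge2 parked.
have : all (fun a => p <= a <= p - 2 + #|J|) (restriction alpha J).
  by apply/allP => a /mapP[j]; rewrite mem_enum => /J_in j_in ->.
have := restriction_subseq alpha J; have := size_tuple (restriction alpha J).
rewrite /PP /shift /=; set h := #|J|; move: (map _ (enum J)) => l.
move=> size_l sub_l l_in h_ge l_valid h_ge2; rewrite all_parked_size size_map size_l => /eqP full.
have El : map (addn (p - 2)) (map (fun a => a - (p - 2)) l) = l.
  by apply: map_shiftK; apply: sub_all l_in => a /=; lia.
have sub_L : subseq l [seq a <- alpha | p <= a].
  by rewrite subseq_filter sub_l andbT; apply: sub_all l_in => a /=; lia.
have L_in : all (fun a => 1 <= a <= n) [seq a <- alpha | p <= a] by apply: sub_all_filter.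
(* The translated street fits because only [n - p + 2] cars have preference at least [p]. *)
have h_le : h + (p - 2) <= n.
  suff : h <= count (leq p) alpha by lia.
  by rewrite -size_l -size_filter; apply: size_subseq.
apply/(run_mono L_in sub_L (fun x xO => xO))/negPn/negP => p_free.
have sub := @run_shift_sub n h k (p - 2) [::] [::] _ h_le l_valid.
rewrite El (_ : p - 2 + 1 = p - 1) in sub; last by lia.
have one_in : 1 \in run h k [::] (map (fun a => a - (p - 2)) l).
  have uniq_run := run_uniq k l_valid (isT : uniq [::]).
  have run_in s := mem_run_range (s := s) (k := k) l_valid.
  have sub_iota : {subset run h k [::] (map (fun a => a - (p - 2)) l) <= iota 1 h}.
    by move=> s /run_in; rewrite mem_iota; lia.
  have [|_ ->] := uniq_min_size uniq_run sub_iota; first by rewrite full size_iota.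
  by rewrite mem_iota; lia.
case/negP: (p_free); rewrite -{1}(_ : p - 2 + 1 = p - 1); last by lia.
exact: sub.
Qed.

Lemma cond_i_ii (n k : nat) (alpha : n.-tuple nat) (p q : nat) :
  PP alpha -> maximal_interval (U alpha) p q -> cond_i k alpha p -> cond_ii k alpha p q.
Proof.
move=> alphaP pq_max /cond_iE /minimal_subseq[l [sub_L p_occ minimal]].
have [p_ge2 pq U_pq count_p _] := maximal_interval_bounds alphaP pq_max.
have [l_ge sub_l] : all (leq p) l /\ subseq l alpha.
  by apply/andP; rewrite -subseq_filter.
have l_in : all (fun a => (0 < p - 1) && (p - 1 < a <= n)) l.
  apply/allP => a al; have := allP l_ge a al.
  by have := allP alphaP a (mem_subseq sub_l al) => /=; lia.
have [l_lt parks excess_l] := minimal_complete l_in p_occ minimal.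
have [J EJ] := subseq_restriction sub_l.
have size_l : size l = #|J| by rewrite -EJ size_tuple.
move: l_lt parks excess_l; rewrite size_l; move: size_l.
set h := #|J| => size_l l_lt parks excess_l.
(* Otherwise [p - 1 + h] lies in [[p, q]]. All [h] cars of [l] prefer a spot of [[p, p - 2 + h]],
   which leaves at most [n + 2 - p - h] preferences from [p - 1 + h] on, one too few for positive
   excess. *)
have h_ge : q - p + 2 <= h.
  rewrite leqNgt; apply/negP => h_lt.
  have h_gt0 : 0 < h by rewrite -size_l; case: (l) p_occ.
  have := U_pq (p - 1 + h) ltac:(lia).
  suff : h + count (leq (p - 1 + h)) alpha <= count (leq p) alpha by lia.
  have /eqP h_count : count (fun a => p <= a < p - 1 + h) l == size l.
    rewrite -all_count; apply/allP => a al.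
    by have := allP l_ge a al; have := allP l_lt a al => /=; lia.
  rewrite -{1}size_l -h_count.
  apply: leq_trans (leq_add (leq_count_subseq _ sub_l) (leqnn _)) _.
  by apply: count_add_le => a /=; lia.
have l_in_h : all (fun a => p <= a <= p - 2 + h) l.
  apply/allP => a al.
  by have := allP l_ge a al; have := allP l_lt a al => /=; lia.
have El : map (addn (p - 2)) (map (fun a => a - (p - 2)) l) = l.
  by apply: map_shiftK; apply: sub_all l_in_h => a /=; lia.
have ES : val (shift (p - 2) (restriction alpha J)) = map (fun a => a - (p - 2)) l.
  by rewrite -EJ.
have SP : PP (shift (p - 2) (restriction alpha J)).
  by rewrite /PP ES all_map -/h; apply: sub_all l_in_h => a /=; lia.
exists J; split=> //.
  move=> j jJ; apply: (allP l_in_h); rewrite -EJ /=.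
  by apply: map_f; rewrite mem_enum.
split; first split=> //; first by lia.
  move=> j; rewrite mem_U // ES count_map.
  (* At 1 the excess is 0, as there are as many cars as spots; for larger [j] the bound comes from
     [excess_l] at [p - 2 + j]. *)
  have [->|j_ne1] := eqVneq j 1.
    by have := count_size (preim (fun a => a - (p - 2)) (leq 1)) l; rewrite size_l -/h; lia.
  case: (boolP (2 <= j <= h)) => j_in; last by lia.
  have := excess_l (p - 2 + j) ltac:(lia).
  rewrite (@eq_count _ (preim _ _) (leq (p - 2 + j))); first by lia.
  by move=> a /=; lia.
rewrite /PF SP ES /=.
apply: (@shift_all_parked n h k (p - 2) [::] [::]) => //.
- by rewrite all_map; apply: sub_all l_in_h => a /=; lia.
- rewrite all_map; apply/allP => a al /=.
  by have := allP l_in a al; have := allP l_in_h a al => /=; lia.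
rewrite El => l1 a l2 /parks[s E s_in]; exists s => //; lia.
Qed.

Theorem theorem5p1 (n k : nat) (alpha : n.-tuple nat)
    (k_ge1 : 1 <= k) (alphaP : PP alpha) :
  [/\ forall p q : nat, maximal_interval (U alpha) p q ->
        (cond_i k alpha p <-> cond_ii k alpha p q)
        /\ (q - p + 1 <= k -> cond_i k alpha p /\ cond_ii k alpha p q),
      PF k alpha <->
        (forall p q : nat, maximal_interval (U alpha) p q ->
           k + 1 <= q - p + 1 -> cond_i k alpha p)
    & PF k alpha <->
        (forall p q : nat, maximal_interval (U alpha) p q ->
           k + 1 <= q - p + 1 -> cond_ii k alpha p q)].
Proof.
have equiv p q : maximal_interval (U alpha) p q ->
    cond_i k alpha p <-> cond_ii k alpha p q.
  by move=> pq_max; split; [apply: cond_i_ii|apply: cond_ii_i].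
have PF_i : PF k alpha <-> forall p q, maximal_interval (U alpha) p q ->
    k + 1 <= q - p + 1 -> cond_i k alpha p.
  split=> [parked p q pq_max _|large_i]; first exact: PF_cond_i pq_max.
  (* Intervals of size at most [k] satisfy (i) automatically, so only the larger ones need the
     hypothesis. *)
  apply: cond_i_PF => // p q pq_max; have [small|large] := leqP (q - p + 1) k.
    exact: small_interval_cond_i pq_max small.
  by apply: large_i pq_max _; lia.
split=> //.
  move=> p q pq_max; split; first exact: equiv.
  move=> small; have p_i := small_interval_cond_i alphaP pq_max small.
  by split; last exact/(equiv p q).
rewrite PF_i; split=> large p q pq_max /(large p q pq_max) p_cond.
  exact/(equiv p q).
exact/(equiv p q).
Qed.
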